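(* Let $X$ be a set and let $C\subseteq\{0,1\}^X$ be a finite concept class with $|C|\ge 2$ and VC-dimension $d$. Then there exists a concept $c\in C$ that has a teaching set in $C$ of size at most $$d\,2^{d+3}\left(\log(4e^2)+\log\log|C|\right).$$
   Context: A concept class over a set $X$ is a set $C\subseteq\{0,1\}^X$ of functions $X\to\{0,1\}$; its elements are called concepts. A set $Y\subseteq X$ is shattered by $C$ if for every $Z\subseteq Y$ there is $c\in C$ with $c(x)=1$ for all $x\in Z$ and $c(x)=0$ for all $x\in Y\setminus Z$. The VC-dimension of $C$ is the maximum size of a subset of $X$ shattered by $C$. A set $Y\subseteq X$ is a teaching set for $c\in C$ in $C$ if for every $c'\in C$ with $c'\neq c$ we have $c'|_Y\neq c|_Y$. Logarithms are to base $2$; $e$ is the base of the natural logarithm. *)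

(* Defs.v *)
From mathcomp Require Import all_boot all_order all_algebra.
From mathcomp Require Import boolp classical_sets functions cardinality.
From mathcomp Require Import reals sequences exp.

Set Implicit Arguments.
Unset Strict Implicit.
Unset Printing Implicit Defensive.

Local Open Scope classical_set_scope.
Local Open Scope card_scope.

Definition concept_class (X : Type) := set (X -> bool).

Definition shattered (X : Type) (C : concept_class X) (Y : set X) : Prop :=
  forall Z : set X, Z `<=` Y ->
    exists2 c, C c &
      (forall x, Z x -> c x = true) /\ (forall x, (Y `\` Z) x -> c x = false).

(* [d] is a maximum, not just a supremum: infinite shattered sets are excluded
   by the second conjunct, and an empty class has no VC-dimension. *)
Definition VC_dimension (X : Type) (C : concept_class X) (d : nat) : Prop :=
  (exists2 Y : set X, shattered C Y & Y #= `I_d) /\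
  (forall Y : set X, shattered C Y -> Y #<= `I_d).

Definition teaching_set (X : Type) (C : concept_class X) (c : X -> bool)
    (Y : set X) : Prop :=
  forall c', C c' -> c' <> c -> ~ (forall x, Y x -> c' x = c x).

Local Open Scope ring_scope.

Definition log2 (R : realType) (x : R) : R := ln x / ln 2.

(* Main.v *)
(** Let [F] be a finite class of VC-dimension at most [d]. Its dual class, the set of
    distinct columns [{A in F | x in A}], has VC-dimension at most [D = 2 ^ (d + 1)],
    and it has at least about [#|F| ^ (1 / d)] members by Sauer's lemma. If [F] is
    large, two of these columns must be close: otherwise a small random sample of
    concepts would separate too many of them. So for some [x], [y] the concepts
    that contain [x] but not [y] form a nonempty subclass of size at most
    [#|F| ^ (1 - 1 / K)], where [K = d * D * 2]. Passing to it costs two points and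
    lowers [log log #|F|] by at least [1 / K]. Once [log #|F| <= 9 * K], repeatedly
    passing to the smaller half finishes with at most [9 * K] further points, which
    fits because [2 * log2 (4 * e ^ 2) >= 9]. *)

Require Import Defs.
From mathcomp Require Import all_boot.

Set Implicit Arguments.
Unset Strict Implicit.
Unset Printing Implicit Defensive.

(** * Shattering and Sauer's lemma for finite set systems *)

Definition shatters (T : finType) (F : {set {set T}}) (Y : {set T}) :=
  [forall Z : {set T}, (Z \subset Y) ==> [exists A in F, A :&: Y == Z]].

Lemma shattersP (T : finType) (F : {set {set T}}) (Y : {set T}) :
  reflect (forall Z : {set T}, Z \subset Y -> exists2 A, A \in F & A :&: Y = Z)
          (shatters F Y).
Proof.
apply: (iffP forallP) => [h Z ZY|h Z].
  by have /exists_inP[A AF /eqP AZ] := implyP (h Z) ZY; exists A.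
by apply/implyP => /h[A AF AZ]; apply/exists_inP; exists A => //; apply/eqP.
Qed.

Lemma shattersS (T : finType) (F F' : {set {set T}}) (Y : {set T}) :
  F \subset F' -> shatters F Y -> shatters F' Y.
Proof.
move=> FF' /shattersP h; apply/shattersP => Z /h[A AF AZ].
by exists A => //; apply: (subsetP FF').
Qed.

Lemma exists_separating_point (T : finType) (F : {set {set T}}) :
  1 < #|F| -> exists x, 0 < #|[set A in F | x \in A]| < #|F|.
Proof.
case/card_gt1P => A [B [AF BF AB]].
have /existsP[x xAB] : [exists x, (x \in A) != (x \in B)].
  apply: contraNT AB; rewrite negb_exists => /forallP h.
  by apply/eqP/setP => x; apply/eqP; have := h x; rewrite negbK.
exists x; rewrite (cardsD1 A F) AF /= card_gt0.
apply/andP; split.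
  apply/set0Pn; case xA: (x \in A) xAB => xB; first by exists A; rewrite inE AF.
  by exists B; rewrite inE BF; move: xB; case: (x \in B).
have : [set A in F | x \in A] \proper F.
  apply/properP; split; first by apply/subsetP => E; rewrite inE => /andP[].
  case xA: (x \in A) xAB => xB; last by exists A; rewrite // inE AF xA.
  by exists B; rewrite // inE BF; move: xB; case: (x \in B).
by move/proper_card; rewrite [X in _ < X -> _](cardsD1 A F) AF.
Qed.

Lemma card_split (T : finType) (F : {set {set T}}) x :
  #|[set A in F | x \in A]| + #|[set A in F | x \notin A]| = #|F|.
Proof.
rewrite -(cardsID [set A : {set T} | x \in A] F).
by congr (_ + _); apply: eq_card => A; rewrite !inE // andbC.
Qed.

(* Splitting [F] at a point [x]: a set shattered by both halves avoids [x], and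
   adding [x] to it gives a set shattered by [F] but by neither half. *)
Lemma leq_card_shattered (T : finType) (F : {set {set T}}) :
  #|F| <= #|[set Y | shatters F Y]|.
Proof.
have [n] := ubnP #|F|; elim: n F => // n IHn F; rewrite ltnS => leFn.
have [F_le1|F_gt1] := leqP #|F| 1.
  have [->|[A AF]] := set_0Vmem F; first by rewrite cards0.
  apply: (leq_trans F_le1); rewrite card_gt0; apply/set0Pn; exists set0.
  rewrite inE; apply/shattersP => Z; rewrite subset0 => /eqP->.
  by exists A; rewrite ?setI0.
have [x /andP[F1gt0 F1lt]] := exists_separating_point F_gt1.
have Fsplit := card_split F x.
set F1 := [set A in F | x \in A] in F1gt0 F1lt Fsplit *.
set F0 := [set A in F | x \notin A] in Fsplit *.
have F0lt : #|F0| < #|F| by rewrite -Fsplit -[X in X < _]add0n ltn_add2r.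
have /IHn IH1 : #|F1| < n by apply: leq_trans leFn.
have /IHn IH0 : #|F0| < n by apply: leq_trans leFn.
rewrite -Fsplit; apply: leq_trans (leq_add IH1 IH0) _.
set S1 := [set Y | shatters F1 Y]; set S0 := [set Y | shatters F0 Y].
have S1x Y : Y \in S1 -> x \notin Y.
  rewrite inE => /shattersP h; apply/negP => xY.
  have [|A] := h set0; first exact: sub0set.
  by rewrite inE => /andP[_ xA] /setP/(_ x); rewrite !inE xA xY.
have S0x Y : Y \in S0 -> x \notin Y.
  rewrite inE => /shattersP h; apply/negP => xY.
  have [|A] := h [set x]; first by rewrite sub1set.
  by rewrite inE => /andP[_ xA] /setP/(_ x); rewrite !inE (negPf xA) eqxx.
have FS1 : F1 \subset F by apply/subsetP => A; rewrite inE => /andP[].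
have FS0 : F0 \subset F by apply/subsetP => A; rewrite inE => /andP[].
(* The sum splits into union plus intersection of [S1] and [S0]. The intersection is counted by the
   sets [x |: Y], which contain [x] and so lie outside the union. *)
rewrite -cardsUI.
have injU : {in S1 :&: S0 &, injective (fun Y : {set T} => x |: Y)}.
  move=> Y Z; rewrite !inE => /andP[Y1 _] /andP[Z1 _] eqYZ.
  have xY : x \notin Y by apply: S1x; rewrite inE.
  have xZ : x \notin Z by apply: S1x; rewrite inE.
  by rewrite -(setU1K xY) eqYZ setU1K.
rewrite -(card_in_imset injU).
have disj : [disjoint S1 :|: S0 & [set x |: Y | Y in S1 :&: S0]].
  rewrite disjoint_subset; apply/subsetP => Y YU; apply/negP => /imsetP[Z _ eYZ].
  have : x \notin Y by case/setUP: YU => [/S1x|/S0x].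
  by rewrite eYZ setU11.
rewrite -cardsUI (disjoint_setI0 disj) cards0 addn0.
apply/subset_leq_card/subsetP => Y /setUP[/setUP[]|/imsetP[Z]].
- by rewrite !inE; apply: shattersS.
- by rewrite !inE; apply: shattersS.
move=> /setIP[Z1 Z0] ->; have xZ := S1x _ Z1.
move: Z1 Z0; rewrite !inE => /shattersP h1 /shattersP h0.
apply/shattersP => W WxZ.
have WZ : W :\ x \subset Z by rewrite subDset.
case xW: (x \in W).
  have [A] := h1 _ WZ; rewrite inE => /andP[AF xA] eqA.
  exists A => //; rewrite setIUr eqA -[RHS](setD1K xW); congr (_ :|: _).
  by apply/setIidPr; rewrite sub1set.
have [A] := h0 _ WZ; rewrite inE => /andP[AF xA] eqA.
exists A => //; rewrite setIUr eqA; apply/setP => y; rewrite !inE.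
by have [->|] := eqVneq y x; rewrite ?(negPf xA) ?xW ?andbF.
Qed.

Definition VC_le (T : finType) (F : {set {set T}}) d :=
  forall Y, shatters F Y -> #|Y| <= d.

Lemma VC_leS (T : finType) (F F' : {set {set T}}) d :
  F \subset F' -> VC_le F' d -> VC_le F d.
Proof. by move=> FF' h Y /(shattersS FF') /h. Qed.

Lemma card_subsets_le (T : finType) (S : {set T}) d :
  #|[set Y : {set T} | (Y \subset S) && (#|Y| <= d)]| = \sum_(i < d.+1) 'C(#|S|, i).
Proof.
elim: d => [|d IHd].
  rewrite big_ord1 bin0; apply/eqP/cards1P; exists set0; apply/setP => Y.
  rewrite !inE leqn0 cards_eq0 andbC.
  by have [->|] := eqVneq Y set0; rewrite ?sub0set.
rewrite big_ord_recr /= -IHd -cards_draws.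
rewrite -cardsUI [X in _ + X](_ : _ = 0) ?addn0.
  apply: eq_card => Y; rewrite !inE leq_eqVlt ltnS.
  by case: (Y \subset S); rewrite //= orbC.
apply/eqP; rewrite cards_eq0; apply/eqP/setP => Y; rewrite !inE.
by apply/negP => /andP[/andP[_ h] /andP[_ /eqP e]]; rewrite e ltnn in h.
Qed.

(** A set shattered by the traces lies in [S] and is shattered by [F], so [leq_card_shattered]
    counts only subsets of [S] of size at most [d]. *)
Lemma sauer_trace (T : finType) (F : {set {set T}}) (S : {set T}) d :
  VC_le F d -> #|[set A :&: S | A in F]| <= \sum_(i < d.+1) 'C(#|S|, i).
Proof.
move=> vcF; apply: leq_trans (leq_card_shattered _) _.
rewrite -card_subsets_le; apply/subset_leq_card/subsetP => Y; rewrite !inE.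
move=> /shattersP h.
have YS : Y \subset S.
  have [_ /imsetP[A _ ->] <-] := h Y (subxx Y).
  by rewrite -setIA setICA subsetIl.
rewrite YS; apply: vcF; apply/shattersP => Z /h[_ /imsetP[A AF ->] <-].
by exists A => //; rewrite -setIA (setIidPr YS).
Qed.

(** * Estimates for sums of binomial coefficients *)

Lemma sum_bin_leq_exp m d : \sum_(i < d.+1) 'C(m, i) <= m.+1 ^ d.
Proof.
rewrite -(add1n m) expnDn; apply: leq_sum => i _.
rewrite exp1n mul1n.
have le_bin : 'C(m, i) <= m ^ i.
  rewrite -(leq_pmul2r (fact_gt0 i)) bin_ffact.
  apply: leq_trans (leq_pmulr _ (fact_gt0 i)).
  elim: (nat_of_ord i) m => // {i}k IHk m; rewrite ffactnS expnS leq_mul //.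
  apply: leq_trans (IHk _) _.
  by case: k {IHk} => // k; rewrite leq_exp2r ?leq_pred.
by apply: leq_trans le_bin _; apply: leq_pmull; rewrite bin_gt0 -ltnS.
Qed.

(** Integer form of [(1 + 1 / w) ^ w <= 4] for even [w]: a Bernoulli estimate gives
    [(1 + 1 / w) ^ (w / 2) <= 2], which is then squared. *)
Lemma exp_succ_le4 v : 0 < v -> (v.*2.+1) ^ v.*2 <= 4 * v.*2 ^ v.*2.
Proof.
move=> v0; set w := v.*2.
have bern k : w.+1 ^ k <= w ^ k + k * w.+1 ^ k.-1.
  elim: k => // k IHk; rewrite expnS mulSn.
  have -> : w.+1 ^ k + w * w.+1 ^ k = w.+1 * w.+1 ^ k by rewrite mulSn.
  rewrite mulSn addnC.
  apply: leq_trans (_ : w * (w ^ k + k * w.+1 ^ k.-1) + w.+1 ^ k <= _).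
    by rewrite leq_add2r leq_mul2l IHk orbT.
  rewrite mulnDr -expnS -addnA leq_add2l /= mulSn addnC leq_add2l.
  rewrite mulnCA leq_mul2l; case: k {IHk} => //= k.
  by rewrite expnS leq_mul2r leqnSn orbT.
have half : w.+1 ^ v <= 2 * w ^ v.
  have := bern v; rewrite -(leq_pmul2l (isT : 0 < 2)) mulnDr.
  have : 2 * (v * w.+1 ^ v.-1) <= w.+1 ^ v.
    by case: v v0 @w bern => // v _ w _; rewrite mulnA mul2n -/w expnS leq_mul2r leqnSn orbT.
  by move=> h1 h2; have := leq_trans h2 (leq_add (leqnn _) h1); rewrite mul2n -addnn leq_add2r.
have pow_w x : x ^ w = x ^ v * x ^ v by rewrite /w -addnn expnD.
by rewrite !pow_w -[4]/(2 * 2) mulnACA leq_mul.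
Qed.

(** The usual bound [(e * m / D) ^ D] with 4 for [e]. For [w = v.*2], after multiplication by
    [w ^ (D * w - D)] the terms are bounded by those of [(w + 1) ^ (D * w)]. *)
Lemma sum_bin_leq D v : 0 < v -> \sum_(i < D.+1) 'C(D * v.*2, i) <= (4 * v.*2) ^ D.
Proof.
move=> v0; set w := v.*2.
have w0 : 0 < w by rewrite double_gt0.
have sD : D <= D * w by rewrite leq_pmulr.
have wp : 0 < w ^ (D * w - D) by rewrite expn_gt0 w0.
rewrite -(leq_pmul2r wp).
have -> : (4 * w) ^ D * w ^ (D * w - D) = (4 * w ^ w) ^ D.
  by rewrite !expnMn -mulnA -expnD subnKC // -expnM (mulnC w D).
apply: leq_trans (_ : w.+1 ^ (D * w) <= _); last first.
  rewrite mulnC expnM; have [->//|D0] := posnP D.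
  by rewrite leq_exp2r // exp_succ_le4.
rewrite -(addn1 w) expnDn big_distrl /=.
rewrite (big_ord_widen (D * w).+1 (fun i => 'C(D * w, i) * w ^ (D * w - D))) //.
rewrite [X in X <= _]big_mkcond; apply: leq_sum => i _; case: ifP => // iD.
by rewrite exp1n muln1 leq_mul2l leq_pexp2l ?orbT // leq_sub2l.
Qed.

(** * The dual class: its size and VC-dimension *)

Section Dual.
Variables (T : finType) (F : {set {set T}}).

Definition column x := [set A in F | x \in A].
Definition columns := [set column x | x : T].

(** One point per distinct column already tells all members of [F] apart, so Sauer's bound on these
    points applies to [#|F|]. *)
Lemma card_leq_columns d : VC_le F d -> #|F| <= #|columns|.+1 ^ d.
Proof.
move=> vcF.
(* The pick always succeeds, so the default is never reached and [f x] depends only on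
   [column x]. *)
pose f x := odflt x [pick y | column y == column x].
have fP x : column (f x) = column x.
  by rewrite /f; case: pickP => [y /eqP|/(_ x)]; rewrite ?eqxx.
have f_inj x y : column x = column y -> f x = f y.
  move=> e; rewrite /f e; case: pickP => // /(_ y); by rewrite eqxx.
have cardP : #|[set f x | x : T]| = #|columns|.
  rewrite /columns -(card_in_imset (f := column) (D := [set f x | x : T])).
    rewrite -imset_comp; congr #|pred_of_set _|.
    by apply: eq_imset => x /=.
  by move=> _ _ /imsetP[x _ ->] /imsetP[y _ ->]; rewrite !fP; apply: f_inj.
have traceI : {in F &, injective (fun A => A :&: [set f x | x : T])}.
  have memf A x : A \in F -> (f x \in A) = (x \in A).
    by move=> AF; have /setP/(_ A) := fP x; rewrite !inE AF.
  move=> A B AF BF /setP e; apply/setP => x.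
  by have := e (f x); rewrite !inE imset_f // !andbT !memf.
rewrite -(card_in_imset traceI) -cardP.
exact: leq_trans (sauer_trace _ vcF) (sum_bin_leq_exp _ _).
Qed.

(* Label [2 ^ d.+1] members of a set of concepts shattered by the columns by the
   subsets of a [d.+1]-element set: the columns selecting the labels that
   contain a given index are [d.+1] points shattered by [F]. *)
Lemma VC_le_columns d : VC_le F d -> VC_le columns (2 ^ d.+1).
Proof.
move=> vcF S shS; rewrite leqNgt; apply/negP => /ltnW leS.
have card_lab : #|{set 'I_d.+1}| <= #|S|.
  by rewrite -cardsT -powersetT card_powerset cardsT card_ord.
pose h (J : {set 'I_d.+1}) : {set T} := enum_val (widen_ord card_lab (enum_rank J)).
have hS J : h J \in S by apply: enum_valP.
have h_inj : injective h.
  by move=> I J /enum_val_inj/(congr1 val)/= /ord_inj/enum_rank_inj.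
have hF J : h J \in F.
  have /shattersP/(_ S (subxx S))[_ /imsetP[x _ ->]] := shS.
  by move=> /setP/(_ (h J)); rewrite !inE hS andbT => /andP[].
have xP i : exists x, forall J, (x \in h J) = (i \in J).
  have sub : h @: [set J : {set 'I_d.+1} | i \in J] \subset S.
    by apply/subsetP => _ /imsetP[J _ ->].
  have /shattersP/(_ _ sub)[_ /imsetP[x _ ->] /setP e] := shS.
  exists x => J; have := e (h J); rewrite !inE hF hS andbT /= => ->.
  by rewrite mem_imset // inE.
have {xP}[f fP] := fin_all_exists xP.
have f_inj : injective f.
  move=> i j e; have := fP j [set i]; rewrite -e fP !inE eqxx.
  by move/esym/eqP.
have /vcF : shatters F (f @: setT).
  apply/shattersP => Z /subsetP ZY; exists (h (f @^-1: Z)) => //.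
  apply/setP => x; rewrite inE andbC.
  case: (boolP (x \in f @: setT)) => [/imsetP[i _ ->]|/= xf].
    by rewrite fP inE.
  by apply/esym/negP => /ZY; apply/negP.
by rewrite card_imset // cardsT card_ord ltnn.
Qed.

End Dual.

(** * Sampling concepts to find two close columns *)

(** Random sampling made greedy: by averaging, some member of a nonempty [F] leaves at most a
    fraction [1 - q / #|F|] of the remaining [u] unseparated; it joins the sample. *)
Lemma separating_sample (T U : finType) (F : {set T}) (Q : {set U})
    (sep : U -> T -> bool) q s :
    (forall u, u \in Q -> q <= #|[set A in F | sep u A]|) ->
  exists2 S : {set T}, #|S| <= s &
    #|[set u in Q | [forall A in S, ~~ sep u A]]| * #|F| ^ s
      <= #|Q| * (#|F| - q) ^ s.
Proof.
move=> sepQ; elim: s => [|s [S cS leS]].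
  exists set0; rewrite ?cards0 // leq_mul2r subset_leq_card ?orbT //.
  by apply/subsetP => u; rewrite inE => /andP[].
set Q' := [set u in Q | _] in leS.
pose R A := [set u in Q' | ~~ sep u A].
have sumR : \sum_(A in F) #|R A| <= #|Q'| * (#|F| - q).
  under eq_bigr do rewrite -sum1_card.
  rewrite (exchange_big_dep (mem Q')) /=; last by move=> A u _; rewrite inE => /andP[].
  rewrite -sum_nat_const; apply: leq_sum => u uQ'.
  have uQ : u \in Q by move: uQ'; rewrite inE => /andP[].
  rewrite leq_subRL; last first.
    by apply: leq_trans (sepQ u uQ) _; apply/subset_leq_card/subsetP => A; rewrite inE => /andP[].
  rewrite -(cardsID [set A | sep u A] F).
  apply: leq_add.
    apply: leq_trans (sepQ u uQ) _; apply: eq_leq.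
    by apply: eq_card => A; rewrite !inE.
  rewrite sum1_card; apply/subset_leq_card/subsetP => A; rewrite !inE.
  by rewrite unfold_in /= inE => /andP[-> /andP[_ ->]].
have [F0|[B BF]] := set_0Vmem F.
  by exists S; [apply: leqW | rewrite F0 cards0 exp0n ?muln0].
have [A AF leA] : exists2 A, A \in F & #|R A| * #|F| <= #|Q'| * (#|F| - q).
  case: (arg_minnP (fun A => #|R A|) BF) => A AF minA; exists A => //.
  by apply: leq_trans sumR; rewrite mulnC -sum_nat_const leq_sum.
exists (A |: S); first by apply: leq_trans (leq_card_setU _ _) _; rewrite cards1.
have sub : [set u in Q | [forall A' in A |: S, ~~ sep u A']] \subset R A.
  apply/subsetP => u; rewrite !inE => /andP[-> /forall_inP h].
  rewrite h ?setU11 // andbT; apply/forall_inP => A' A'S.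
  by rewrite h // inE A'S orbT.
apply: leq_trans (_ : #|R A| * #|F| ^ s.+1 <= _).
  by rewrite leq_mul2r subset_leq_card ?orbT.
rewrite !expnS mulnA.
apply: leq_trans (_ : #|Q'| * (#|F| - q) * #|F| ^ s <= _).
  by rewrite leq_mul2r leA orbT.
by rewrite mulnAC [X in _ <= X]mulnCA [X in _ <= X]mulnC leq_mul2r leS orbT.
Qed.

(** Bernoulli: with [u = n - q], [(u + q) ^ z >= u ^ z + z * q * u ^ (z - 1)], and
    [z * q >= n >= u]. *)
Lemma expn_half n q z : 0 < z -> n <= q * z -> 2 * (n - q) ^ z <= n ^ z.
Proof.
move=> z0 le_n.
have [nq|/ltnW qn] := leqP n q.
  by rewrite (eqP (nq : n - q == 0)) exp0n ?muln0.
rewrite -{2}(subnK qn); set u := n - q.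
have bern k : u ^ k + k * q * u ^ k.-1 <= (u + q) ^ k.
  elim: k => // k IHk; rewrite [X in _ <= X]expnS.
  apply: leq_trans (leq_mul (leqnn _) IHk).
  have -> : k.+1 * q * u ^ k.+1.-1 = q * u ^ k + u * (k * q * u ^ k.-1).
    rewrite /= mulSn mulnDl; congr (_ + _).
    by case: k {IHk} => [|k]; rewrite ?muln0 //= expnS mulnCA.
  by rewrite mulnDr !mulnDl -expnS !addnA leq_addr.
apply: leq_trans (bern z); rewrite mul2n -addnn leq_add2l.
case: z z0 le_n => // z _ le_n /=; rewrite expnS leq_mul2r mulnC.
by rewrite (leq_trans (leq_subr q n)) ?orbT.
Qed.

(** The inequality fails at [a = 8]; this is the source of the 9 in the threshold [9 * K]. *)
Lemma linear_lt_exp a : 9 <= a -> 32 * a + 8 < 2 ^ a.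
Proof.
elim: a => // a IHa; rewrite leq_eqVlt => /orP[/eqP<-//|a9].
rewrite ltnS in a9; have h := IHa a9.
rewrite expnS mul2n -addnn mulnS -addnA -addSn leq_add //.
  by apply: leq_ltn_trans h; rewrite -{1}[32]addn0 leq_add // leq_pmulr // (leq_trans _ a9).
exact: ltnW.
Qed.

Lemma subset_of_card (T : finType) (A : {set T}) m :
  m <= #|A| -> exists2 B : {set T}, B \subset A & #|B| = m.
Proof.
case/card_geqP => s [us <- sA]; exists [set x in s].
  by apply/subsetP => x; rewrite inE => /sA.
by rewrite cardsE; apply/card_uniqP.
Qed.

(* If all distinct columns differed on more than [#|F| / 2 ^ a.+1] concepts, then
   [(4 * a + 1) * D * 2 ^ a.+1] sampled concepts would separate [2 ^ (2 * a * D)]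
   columns, which is more than Sauer's bound for VC-dimension [D]. *)
Lemma exists_small_split (T : finType) (F : {set {set T}}) d a :
    VC_le F d -> 9 <= a -> 2 ^ (a * (d * 2 ^ d.+2)) < #|F| ->
  exists x y, 0 < #|[set A in F | (x \in A) && (y \notin A)]| /\
    #|[set A in F | (x \in A) && (y \notin A)]| * 2 ^ a.+1 <= #|F|.
Proof.
move=> vcF a9 Fbig.
pose diff x y := [set A in F | (x \in A) && (y \notin A)].
suff /existsP[x /existsP[y /andP[h1 h2]]] : [exists x, exists y,
    (0 < #|diff x y|) && (#|diff x y| * 2 ^ a.+1 <= #|F|)] by exists x, y.
apply/contraT; rewrite negb_exists => /forallP far.
set D := 2 ^ d.+1.
have D0 : 0 < D by rewrite expn_gt0.
(* Otherwise [card_leq_columns] gives [#|F| <= 2 ^ (2 * a * D * d)], whose exponent is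
   [a * (d * 2 ^ d.+2)]. *)
have leG : 2 ^ (2 * a * D) <= #|columns F|.
  rewrite leqNgt; apply/negP => ltG; move: Fbig; apply/negP; rewrite -leqNgt.
  apply: leq_trans (card_leq_columns vcF) _.
  have -> : a * (d * 2 ^ d.+2) = 2 * a * D * d.
    by rewrite /D (expnS 2 d.+1) mulnCA (mulnC d) !mulnA (mulnC a).
  by rewrite expnM; have [->//|d0] := posnP d; rewrite leq_exp2r.
have [G subG cardG] := subset_of_card leG.
have Fgt0 : 0 < #|F| by apply: leq_trans Fbig.
(* The least integer strictly above [#|F| / 2 ^ a.+1]. *)
pose q := (#|F| %/ 2 ^ a.+1).+1.
have farq x y : 0 < #|diff x y| -> q <= #|diff x y|.
  move=> xy0; have := far x; rewrite negb_exists => /forallP/(_ y).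
  by rewrite xy0 /= -ltnNge => h; rewrite /q ltn_divLR ?expn_gt0.
pose Q := [set u in setX G G | u.1 != u.2].
pose sep (u : {set {set T}} * {set {set T}}) A := (A \in u.1) != (A \in u.2).
have sepQ u : u \in Q -> q <= #|[set A in F | sep u A]|.
  case: u => g h; rewrite !inE /= => /andP[/andP[gG hG] gh].
  have /imsetP[x _ eg] := subsetP subG _ gG.
  have /imsetP[y _ eh] := subsetP subG _ hG.
  have subsep z t : (z, t) \in [:: (x, y); (y, x)] ->
      #|diff z t| <= #|[set A in F | sep (g, h) A]|.
    move=> zt; apply/subset_leq_card/subsetP => A; rewrite !inE /sep /= eg eh !inE.
    move=> /and3P[-> zA tA] /=; move: zt zA tA; rewrite !inE !xpair_eqE.
    by case/orP => /andP[/eqP-> /eqP->] -> /negPf->.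
  (* Distinct columns have at least one nonempty one-sided difference, which [farq] makes large. *)
  have [xy0|] := posnP #|diff x y|; last first.
    by move/farq/leq_trans; apply; apply: subsep; rewrite !inE eqxx.
  have [yx0|] := posnP #|diff y x|; last first.
    by move/farq/leq_trans; apply; apply: subsep; rewrite !inE eqxx orbT.
  case/eqP: gh; rewrite eg eh; apply/setP => A; rewrite !inE.
  case AF: (A \in F) => //=.
  have /setP/(_ A) := cards0_eq xy0; have /setP/(_ A) := cards0_eq yx0.
  by rewrite !inE AF; case: (x \in A); case: (y \in A).
(* Every [2 ^ a.+1] samples halve the unseparated pairs, and [r] halvings leave none of the at most
   [2 ^ (4 * a * D)] pairs. [v] brings the sample size [2 ^ a.+1 * r] into the form [D * v.*2] of
   [sum_bin_leq]. *)
set r := (4 * a).+1 * D.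
pose v := (4 * a).+1 * 2 ^ a.
have v0 : 0 < v by rewrite muln_gt0 expn_gt0.
have eq_s : D * v.*2 = 2 ^ a.+1 * r.
  by rewrite -mul2n /v /r expnS [LHS]mulnC -!mulnA [in LHS](mulnCA _ (2 ^ a)).
have [S leS unsep] := separating_sample (D * v.*2) sepQ.
have Q0 : #|[set u in Q | [forall A in S, ~~ sep u A]]| = 0.
  apply/eqP; rewrite -leqn0 -ltnS -(@ltn_pmul2r (2 ^ r * #|F| ^ (D * v.*2))); last first.
    by rewrite muln_gt0 !expn_gt0 Fgt0.
  rewrite mul1n mulnCA.
  apply: leq_ltn_trans (leq_mul (leqnn _) unsep) _.
  rewrite mulnCA.
  have le_half : 2 ^ r * (#|F| - q) ^ (D * v.*2) <= #|F| ^ (D * v.*2).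
    rewrite eq_s !(expnM _ _ r) -expnMn leq_exp2r; last by rewrite /r muln_gt0 D0.
    apply: expn_half; first by rewrite expn_gt0.
    by rewrite ltnW // ltn_ceil // expn_gt0.
  apply: leq_ltn_trans (leq_mul (leqnn _) le_half) _.
  rewrite ltn_pmul2r ?expn_gt0 ?Fgt0 //.
  apply: leq_ltn_trans (_ : #|setX G G| < _).
    by apply/subset_leq_card/subsetP => u; rewrite inE => /andP[].
  rewrite cardsX cardG -expnD ltn_exp2l // -mulnDl /r ltn_pmul2r //.
  by rewrite -mulnDl.
have traceI : {in G &, injective (fun g => g :&: S)}.
  move=> g h gG hG /setP e; apply: contraTeq (introT eqP Q0) => gh.
  rewrite -lt0n card_gt0; apply/set0Pn; exists (g, h).
  rewrite !inE /= gG hG gh /=; apply/forall_inP => A AS; rewrite /sep /= negbK.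
  by have := e A; rewrite !inE AS !andbT => ->.
have vcG : VC_le G D by apply: VC_leS subG (VC_le_columns vcF).
have := sauer_trace S vcG; rewrite card_in_imset // cardG.
rewrite leqNgt => /negP[].
(* Here [4 * v.*2 = (32 * a + 8) * 2 ^ a], which is below [2 ^ a * 2 ^ a]. *)
apply: leq_ltn_trans (_ : (4 * v.*2) ^ D < _).
  apply: leq_trans (sum_bin_leq D v0); apply: leq_sum => i _.
  exact: leq_bin2l.
have -> : 2 ^ (2 * a * D) = (2 ^ a * 2 ^ a) ^ D by rewrite -expnD addnn -mul2n -expnM.
rewrite ltn_exp2r // -mul2n /v !mulnA ltn_pmul2r ?expn_gt0 //.
by apply: leq_trans (linear_lt_exp a9); rewrite ltnS mulnS mulnA addnC.
Qed.

(** * Teaching sets, passage to subclasses and halving *)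

Definition teaches (T : finType) (F : {set {set T}}) (A Y : {set T}) :=
  forall B, B \in F -> B :&: Y = A :&: Y -> B = A.

(** The recursion step: the points of [Y'] reduce [F] to the subclass given by [P], within which [Y]
    teaches [A]. *)
Lemma teachesU (T : finType) (F : {set {set T}}) (P : pred {set T})
    (A Y Y' : {set T}) :
    (forall B, B \in F -> B :&: Y' = A :&: Y' -> P B) ->
    teaches [set B in F | P B] A Y ->
  teaches F A (Y' :|: Y).
Proof.
move=> hP h B BF e.
have cap (Z : {set T}) : Z \subset Y' :|: Y -> B :&: Z = A :&: Z.
  by move=> sZ; rewrite -(setIidPr sZ) !setIA e.
by apply: h; rewrite ?cap ?subsetUr // inE BF hP // cap ?subsetUl.
Qed.

(** At a point where members of [F] differ, the smaller side is nonempty and has at most half of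
    [F]; each point spent halves the class. *)
Lemma halving_teaches (T : finType) (F : {set {set T}}) :
  0 < #|F| -> exists2 A, A \in F & exists2 Y, teaches F A Y & 2 ^ #|Y| <= #|F|.
Proof.
have [n] := ubnP #|F|; elim: n F => // n IHn F; rewrite ltnS => leFn F0.
have [F_le1|F_gt1] := leqP #|F| 1.
  have /cards1P[A ->] : #|F| == 1 by rewrite eqn_leq F_le1.
  exists A; rewrite ?set11 //; exists set0; last by rewrite cards0 cards1.
  by move=> B /set1P.
have [x /andP[F1gt0 F1lt]] := exists_separating_point F_gt1.
have Fsplit := card_split F x.
have [b [b0 leb]] : exists b, 0 < #|[set A in F | (x \in A) == b]| /\
    2 * #|[set A in F | (x \in A) == b]| <= #|F|.
  have e1 : [set A in F | (x \in A) == true] = [set A in F | x \in A].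
    by apply/setP => A; rewrite !inE eqb_id.
  have e0 : [set A in F | (x \in A) == false] = [set A in F | x \notin A].
    by apply/setP => A; rewrite !inE eqbF_neg.
  have [le10|/ltnW le01] := leqP #|[set A in F | x \in A]| #|[set A in F | x \notin A]|.
    by exists true; rewrite e1 F1gt0 -Fsplit mul2n -addnn leq_add2l.
  exists false; rewrite e0 -Fsplit mul2n -addnn leq_add2r; split=> //.
  by rewrite -(ltn_add2l #|[set A in F | x \in A]|) addn0 Fsplit.
have ltb : #|[set A in F | (x \in A) == b]| < n.
  apply: leq_trans leFn; apply: leq_trans leb.
  by rewrite mul2n -addnn -[X in X < _]addn0 ltn_add2l.
have [A] := IHn _ ltb b0; rewrite inE => /andP[AF /eqP xA] [Y tY leY].
exists A => //; exists ([set x] :|: Y).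
  apply: teachesU tY => B _ /setP/(_ x); rewrite !inE eqxx !andbT xA.
  by move=> ->.
apply: leq_trans leb; apply: leq_trans (_ : 2 ^ #|Y|.+1 <= _).
  by rewrite leq_exp2l // (leq_trans (leq_card_setU _ _)) // cards1.
by rewrite expnS leq_mul2l.
Qed.

(** The lower bound on [n] feeds [exists_small_split], the upper one feeds [loglog2_drop] with
    [b = a.+1]. *)
Lemma exists_log_bracket K n c : 0 < K -> 2 ^ (c * K) < n ->
  exists2 a, c <= a & 2 ^ (a * K) < n <= 2 ^ (a.+1 * K).
Proof.
move=> K0 ltn_c.
have ex : exists b, n <= 2 ^ (b * K).
  exists n; apply: leq_trans (ltnW (ltn_expl n (isT : 1 < 2))) _.
  by rewrite leq_exp2l // leq_pmulr.
case: (ex_minnP ex) => -[|a] le_n min_n.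
  by have := leq_trans ltn_c le_n; rewrite leqNgt ltnS expn_gt0.
have lta : 2 ^ (a * K) < n by rewrite ltnNge; apply/negP => /min_n; rewrite ltnn.
exists a; last by rewrite lta.
by have := leq_trans ltn_c le_n; rewrite ltn_exp2l // ltn_pmul2r.
Qed.

(* Logarithm estimates and the bound for finite ground sets *)
From mathcomp Require Import all_boot all_order all_algebra.
From mathcomp Require Import boolp classical_sets functions cardinality.
From mathcomp Require Import reals sequences exp.
From mathcomp Require Import lra.
Import Order.TTheory GRing.Theory Num.Theory.

Section TeachingBound.
Local Open Scope ring_scope.
Variable R : realType.

Lemma ln2_gt0 : 0 < ln (2 : R).
Proof. by rewrite ln_gt0 // ltr1n. Qed.

(** From [expR (1 / 5) >= 6 / 5] and [(6 / 5) ^ 4 > 2]. *)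
Lemma ln2_le : ln (2 : R) <= 4 / 5.
Proof.
rewrite -ler_expR lnK ?posrE ?ltr0n // expRM_natl.
have h : 6 / 5 <= expR (5^-1 : R) by apply: le_trans (expR_ge1Dx _); lra.
have h4 : (6 / 5) ^+ 4 <= expR (5^-1 : R) ^+ 4 by rewrite lerXn2r ?nnegrE ?expR_ge0 //; lra.
by apply: le_trans h4; lra.
Qed.

Lemma log2_4e2_ge : 9 / 2 <= log2 (4 * expR 1 ^+ 2 : R).
Proof.
rewrite /log2 ler_pdivlMr ?ln2_gt0 //.
have -> : 4 * expR 1 ^+ 2 = (2 * expR 1) ^+ 2 :> R by rewrite exprMn -natrX.
rewrite lnXn ?mulr_gt0 ?expR_gt0 // lnM ?posrE ?expR_gt0 // expRK.
by have := ln2_le; lra.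
Qed.

Lemma log2_natX n : log2 ((2 ^ n)%:R : R) = n%:R.
Proof.
by rewrite /log2 natrX lnXn ?ltr0n // -[ln _ *+ n]mulr_natl mulfK // gt_eqF ?ln2_gt0.
Qed.

Lemma ler_log2 (x y : R) : 0 < x -> x <= y -> log2 x <= log2 y.
Proof.
move=> x0 xy; rewrite /log2 ler_pM2r ?invr_gt0 ?ln2_gt0 //.
by rewrite ler_ln ?posrE // (lt_le_trans x0).
Qed.

Lemma log2_nat_ge1 n : (2 <= n)%N -> 1 <= log2 (n%:R : R).
Proof.
by move=> n2; rewrite -[leLHS](log2_natX 1) ler_log2 ?ler_nat.
Qed.

Lemma log2_ge0 (x : R) : 1 <= x -> 0 <= log2 x.
Proof. by move=> x1; rewrite /log2 divr_ge0 ?(ltW ln2_gt0) ?ln_ge0. Qed.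

Lemma log2M (x y : R) : 0 < x -> 0 < y -> log2 (x * y) = log2 x + log2 y.
Proof. by move=> x0 y0; rewrite /log2 lnM ?posrE // mulrDl. Qed.

(* Dividing [n <= 2 ^ (b K)] by [2 ^ b] multiplies [log2 n] by at most
   [1 - 1 / K], which lowers [log2 (log2 n)] by at least [1 / K]. *)
Lemma loglog2_drop (K b n m : nat) : (0 < K)%N -> (2 <= m)%N ->
    (m * 2 ^ b <= n)%N -> (n <= 2 ^ (b * K))%N ->
  1 + K%:R * log2 (log2 m%:R) <= K%:R * log2 (log2 n%:R) :> R.
Proof.
move=> K0 m2 mn nb.
have n2 : (2 <= n)%N by rewrite (leq_trans m2) // (leq_trans _ mn) // leq_pmulr ?expn_gt0.
have u1 := log2_nat_ge1 n2; have v1 := log2_nat_ge1 m2.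
have K0R : 0 < K%:R :> R by rewrite ltr0n.
have vu : log2 m%:R + b%:R <= log2 (n%:R : R).
  rewrite -(log2_natX b) -log2M ?ltr0n ?expn_gt0 ?(leq_trans _ m2) //.
  by rewrite -natrM ler_log2 ?ler_nat // ltr0n muln_gt0 expn_gt0 (leq_trans _ m2).
have ub : log2 (n%:R : R) <= b%:R * K%:R.
  by rewrite -natrM -(log2_natX (b * K)) ler_log2 ?ler_nat // ltr0n (leq_trans _ n2).
set u := log2 n%:R in u1 vu ub *; set v := log2 m%:R in v1 vu *.
have u0 : 0 < u by lra.
have v0 : 0 < v by lra.
have ratio : v / u <= 1 - K%:R^-1.
  rewrite ler_pdivrMr // mulrBl mul1r.
  have : K%:R^-1 * u <= b%:R by rewrite mulrC ler_pdivrMr.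
  by lra.
have lnr : ln (v / u) <= v / u - 1.
  have := @le_ln1Dx R (v / u - 1); rewrite (addrC 1) subrK; apply.
  by have := divr_gt0 v0 u0; lra.
have ln_uv : ln v - ln u <= - K%:R^-1.
  by rewrite -ln_div ?posrE //; lra.
have Kuv : K%:R * ln v + 1 <= K%:R * ln u.
  have := ler_wpM2l (ltW K0R) ln_uv.
  by rewrite mulrN divff ?gt_eqF // mulrBr; lra.
rewrite /log2 !mulrA ler_pdivlMr ?ln2_gt0 // mulrDl mul1r mulfVK ?gt_eqF ?ln2_gt0 //.
by have := ln2_le; lra.
Qed.

(** For [d = 0] the bound by columns leaves at most one concept. This makes [K] positive below. *)
Lemma VC_le_gt0 (T : finType) (F : {set {set T}}) d :
  VC_le F d -> (1 < #|F|)%N -> (0 < d)%N.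
Proof.
by case: d => // /card_leq_columns; rewrite expn0 => /leq_ltn_trans h /h; rewrite ltnn.
Qed.

Lemma finite_teaching_bound (T : finType) (F : {set {set T}}) d :
    VC_le F d -> (1 < #|F|)%N ->
  exists2 A, A \in F & exists2 Y, teaches F A Y &
    #|Y|%:R <= d%:R * 2 ^+ (d + 3) *
      (log2 (4 * expR 1 ^+ 2) + log2 (log2 #|F|%:R)) :> R.
Proof.
have [n] := ubnP #|F|; elim: n F => // n IHn F; rewrite ltnS => leFn vcF F2.
have d0 := VC_le_gt0 vcF F2.
pose K := (d * 2 ^ d.+2)%N.
have K0 : (0 < K)%N by rewrite muln_gt0 d0 expn_gt0.
have K1R : 1 <= K%:R :> R by rewrite ler1n.
(* The factor 2 pays for the two points of each pass, which lowers [K * log2 (log2 #|F|)] by at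
   least 1. *)
have eK : d%:R * 2 ^+ (d + 3) = 2 * K%:R :> R.
  by rewrite addn3 exprS natrM natrX mulrCA.
rewrite eK; rewrite eK in IHn.
have L9 := log2_4e2_ge.
set L := log2 (4 * expR 1 ^+ 2) in L9 IHn *.
have KL : 9 * K%:R <= 2 * K%:R * L by rewrite mulrAC ler_pM2r ?(lt_le_trans ltr01) //; lra.
have ll0 m : (1 < m)%N -> 0 <= 2 * K%:R * log2 (log2 (m%:R : R)).
  by move=> m1; rewrite mulr_ge0 ?log2_ge0 ?log2_nat_ge1 //; lra.
have [small|big] := leqP #|F| (2 ^ (9 * K)).
  have [A AF [Y tY leY]] := halving_teaches (ltnW F2).
  exists A => //; exists Y => //; rewrite mulrDr -[leLHS]addr0 lerD ?ll0 //.
  apply: le_trans KL; rewrite -natrM ler_nat.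
  by rewrite -(@leq_exp2l 2) // (leq_trans leY).
have [a a9 /andP[gtF leF]] := exists_log_bracket K0 big.
have [x [y []]] := exists_small_split vcF a9 gtF.
set F' := [set A in F | _] => F'0 leF'.
have F'F : F' \subset F by apply/fintype.subsetP => A; rewrite inE => /andP[].
have ltF' : (#|F'| < n)%N.
  apply: leq_trans leFn; apply: leq_trans leF'; rewrite expnS mulnCA.
  rewrite mul2n -addnn -[X in (X < _)%N]addn0 -addnS leq_add //.
    by rewrite leq_pmulr ?expn_gt0.
  by rewrite muln_gt0 F'0 expn_gt0.
have extend A Y : A \in F' -> teaches F' A Y ->
    A \in F /\ teaches F A ([set x; y] :|: Y).
  rewrite inE => /and3P[AF xA yA] tY; split=> //; apply: teachesU tY => B _ /setP e.
  have := e y; have := e x; rewrite !inE !eqxx xA (negPf yA) orbT !andbT.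
  by move=> -> ->.
have cardU (Y : {set T}) : #|[set x; y] :|: Y|%:R <= 2 + #|Y|%:R :> R.
  rewrite -natrD ler_nat (leq_trans (leq_card_setU _ _)) // leq_add2r cards2.
  by case: (_ != _).
(* The induction hypothesis does not cover a singleton [F']; there [x] and [y] alone teach, and
   [2 <= 9 * K]. *)
have [F'1|F'2] := leqP #|F'| 1.
  have [A AF' [Y tY leY]] := halving_teaches F'0.
  have /eqP Y0 : #|Y| == 0%N.
    by rewrite -leqn0 -(@leq_exp2l 2) //; apply: leq_trans leY F'1.
  have [AF tA] := extend A Y AF' tY.
  exists A => //; exists ([set x; y] :|: Y) => //.
  apply: le_trans (cardU Y) _; rewrite Y0 addr0.
  have := ll0 _ F2; rewrite mulrDr; lra.
have [A AF' [Y tY leY]] := IHn _ ltF' (VC_leS F'F vcF) F'2.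
have [AF tA] := extend A Y AF' tY.
exists A => //; exists ([set x; y] :|: Y) => //.
apply: le_trans (cardU Y) _.
have := loglog2_drop K0 F'2 leF' leF.
by move: leY; rewrite !mulrDr -!(mulrA 2); lra.
Qed.

End TeachingBound.

(** * Transfer to finite classes over an arbitrary set *)

Local Open Scope classical_set_scope.
Local Open Scope card_scope.
Local Open Scope ring_scope.

Lemma card_set_mem (P : finType) (Y : {set P}) : [set` Y] #= `I_#|Y|.
Proof.
have [->|[p0 p0Y]] := set_0Vmem Y.
  rewrite cards0 II0 card_eq0; apply/eqP/seteqP.
  by split=> x //=; rewrite inE.
have -> : [set` Y] = nth p0 (enum Y) @` `I_#|Y|.
  apply/seteqP; split=> [p /= pY|_ [k /= kY <-]].
    exists (index p (enum Y)); last by rewrite nth_index // mem_enum.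
    by rewrite /= cardE index_mem mem_enum.
  by rewrite -mem_enum mem_nth // -cardE.
apply: inj_card_eq => i j /set_mem /= iY /set_mem /= jY /eqP.
by rewrite nth_uniq -?cardE ?enum_uniq // => /eqP.
Qed.

Theorem theorem1p4 (R : realType) (X : Type) (C : concept_class X) (N d : nat)
    (card_C : C #= `I_N) (N_ge2 : (2 <= N)%N) (vc_C : VC_dimension C d) :
  exists2 c : X -> bool, C c &
    exists (Y : set X) (m : nat),
      [/\ teaching_set C c Y,
          Y #= `I_m &
          (m%:R : R) <=
            d%:R * 2 ^+ (d + 3) *
              (log2 (4 * expR 1 ^+ 2) + log2 (log2 N%:R))].
Proof.
have /card_set_bijP[c [cC c_inj c_surj]] : `I_N #= C by rewrite card_eq_sym.
have c_neq (i j : 'I_N) : i != j -> exists x, c i x != c j x.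
  move=> ij; apply: contrapT => /forallNP same; case/eqP: ij; apply: val_inj.
  apply: c_inj; [apply/mem_set/ltn_ord | apply/mem_set/ltn_ord | apply: funext => x].
  by apply/eqP; have /negP := same x; rewrite negbK.
(* Two distinct concepts give a point of [X], the default for the diagonal pairs. *)
have [x0 _] := @c_neq (Ordinal (ltnW N_ge2)) (Ordinal N_ge2) isT.
(* One point separating each pair of concepts keeps all concepts distinct, so the
   class may be restricted to these finitely many points. *)
have /fin_all_exists[pt ptP] : forall p : 'I_N * 'I_N, exists x,
    p.1 != p.2 -> c p.1 x != c p.2 x.
  move=> [i j] /=; have [->|/c_neq[x]] := eqVneq i j; first by exists x0.
  by exists x.
(* The finite ground set is the type of index pairs [p], each standing for the point [pt p]. *)
pose A_ (i : 'I_N) := [set p | c i (pt p)]%SET.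
have A_inj : injective A_.
  move=> i j /setP/(_ (i, j)); rewrite !inE => e; apply/eqP/contraT.
  by move/(ptP (i, j)); rewrite /= e eqxx.
pose F := [set A_ i | i : 'I_N]%SET.
have cardF : #|F| = N by rewrite card_imset // card_ord.
have CI (i : 'I_N) : C (c i) by apply: cC; apply: ltn_ord.
have vcF : VC_le F d.
  move=> Y /shattersP shY.
  (* [pt] may repeat points, but not on a shattered set: a concept with trace [{p}] tells [p] from
     every other [q] in [Y]. *)
  have pt_inj : {in [set` Y] &, injective pt}.
    move=> p q /set_mem /= pY /set_mem /= qY e; apply/eqP.
    have [|_ /imsetP[i _ ->] /setP eY] := shY [set p]%SET; first by rewrite finset.sub1set.
    have := eY q; have := eY p; rewrite !inE pY qY !andbT eqxx e => ->.
    by rewrite eq_sym => <-.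
  have : shattered C (pt @` [set` Y]).
    move=> Z ZY; pose Z' := [set p in Y | `[< Z (pt p) >]]%SET.
    have [|_ /imsetP[i _ ->] /setP eZ] := shY Z'.
      by apply/fintype.subsetP => p; rewrite inE => /andP[].
    exists (c i) => //; split=> [x Zx|x [[p /= pY <-] nZ]].
      have [p /= pY px] := ZY x Zx; rewrite -px.
      by have := eZ p; rewrite !inE pY andbT px => ->; apply/asboolP.
    have := eZ p; rewrite !inE pY andbT => ->.
    by apply/asboolP.
  move/(vc_C.2); rewrite (card_le_eql (inj_card_eq pt_inj)).
  by rewrite (card_le_eql (card_set_mem Y)) card_le_II.
have F2 : (1 < #|F|)%N by rewrite cardF.
have [_ /imsetP[i _ ->] [Y tY leY]] := finite_teaching_bound R vcF F2.
exists (c i) => //; exists (pt @` [set` Y]).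
have leYI : pt @` [set` Y] #<= `I_#|Y|.
  by rewrite -(card_le_eqr (card_set_mem Y)) card_image_le.
(* [m] may be smaller than [#|Y|], as [pt] need not be injective on [Y]. *)
have [m cardY] : exists m, pt @` [set` Y] #= `I_m.
  by apply/finite_setP/finite_image; apply: finite_finset.
exists m; split=> //.
  move=> c' /c_surj[j /= jN <-] neq agree; apply: neq.
  have -> : j = Ordinal jN by [].
  congr (c (val _)); apply: A_inj; apply: tY; first by rewrite imset_f.
  apply/setP => p; rewrite !inE; case: (boolP (p \in Y)) => pY; rewrite ?andbF //.
  by rewrite (agree (pt p)) //; exists p.
rewrite -cardF; apply: le_trans leY; rewrite ler_nat -card_le_II.
by rewrite -(card_le_eql cardY).
Qed.
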